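(* Let $n$ be even, let $A=(a_{ij})_{n\times n}$ be a real skew symmetric matrix of order $n$, and let $E=\{(i_l,j_l)\mid l=1,2,\ldots,k\}$ be a non-empty set of $k$ distinct pairs in $[n]\times[n]$ such that $i_1\le i_2\le\cdots\le i_k$ and $i_l<j_l$ for all $l\in[k]$. Then, for any fixed $p\in[k]$, $$Pf(E(A))\,Pf(A)=Pf(E_p(A))\,Pf(\overline{E_p}(A))+a_{i_pj_p}\sum_{1\le l\le k,\ l\ne p}a_{i_lj_l}\Big[f(p,l)\,Pf(E(A)_{\{i_p,j_l\}})\,Pf(A_{\{j_p,i_l\}})-g(p,l)\,Pf(E(A)_{\{i_p,i_l\}})\,Pf(A_{\{j_p,j_l\}})\Big],$$ where $E_p=E\setminus\{(i_p,j_p)\}$, $\overline{E_p}=\{(i_p,j_p)\}$, $f(p,l)=s([n],i_pj_l)\,s([n],j_pi_l)$ and $g(p,l)=s([n],i_pi_l)\,s([n],j_pj_l)$.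
   Context: Notation: $[n]=\{1,2,\ldots,n\}$; when used as a word, $[n]$ means the word $12\cdots n$. Pfaffian: for a skew symmetric matrix $A=(a_{ij})$ of even order $n$, $Pf(A)=\sum_\pi b_\pi$, where $\pi=\{\{s_1,t_1\},\ldots,\{s_{n/2},t_{n/2}\}\}$ ranges over all partitions of $[n]$ into pairs and $b_\pi=\mathrm{sgn}(s_1t_1s_2t_2\cdots s_{n/2}t_{n/2})\prod_{l=1}^{n/2}a_{s_lt_l}$ (independent of the order of pairs and of the order within each pair). The Pfaffian of a skew symmetric matrix of odd order is defined to be $0$. For $I\subseteq[n]$, $A_I$ denotes the matrix obtained from $A$ by deleting the rows and columns indexed by $I$ (the remaining indices kept in increasing order). For a set $E$ of pairs $(i,j)\in[n]\times[n]$ with $i<j$, $E(A)$ denotes the skew symmetric matrix obtained from $A$ by replacing the $(i,j)$- and $(j,i)$-entries by $0$ for every $(i,j)\in E$, leaving all other entries unchanged (so $E(A)=A$ if $E=\emptyset$). $E(A)_I$ means $(E(A))_I$. For words $\alpha,\beta$: $s(\alpha,\beta)=0$ if $\alpha$ or $\beta$ has a repeated letter, or if $\beta$ contains a letter not in $\alpha$; otherwise $s(\alpha,\beta)$ is the sign of the permutation taking $\alpha$ into the word $\beta(\alpha\setminus\beta)$, where $\alpha\setminus\beta$ is the word that remains when the letters of $\beta$ are removed from $\alpha$. *)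

(* Defs.v *)
From mathcomp Require Import all_boot all_order all_fingroup all_algebra.

Set Implicit Arguments.
Unset Strict Implicit.
Unset Printing Implicit Defensive.

Import GRing.Theory.
Local Open Scope ring_scope.

(* The sign of the permutation taking the word u into the word v. If u has no
   repeated letter, there is at most one permutation s with
   v = u_(s 0) u_(s 1) ..., and there is one iff v is a rearrangement of u;
   if there is none, the value is 0. *)
Definition rearr_sign (T : eqType) (u v : seq T) : int :=
  if [pick s : 'S_(size u) |
        v == [tuple tnth (in_tuple u) (s i) | i < size u]] is Some s
  then (-1) ^+ s else 0.

Definition word_sign (T : eqType) (u v : seq T) : int :=
  if [&& uniq u, uniq v & all [in u] v]
  then rearr_sign u (v ++ [seq x <- u | x \notin v]) else 0.

(* The word 12...n; the letters are the elements 0, ..., n-1 of 'I_n. *)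
Definition idword (n : nat) : seq 'I_n := enum 'I_n.

Definition pairings (n : nat) : {set {set {set 'I_n}}} :=
  [set P : {set {set 'I_n}} |
    partition P [set: 'I_n] && [forall B in P, #|B| == 2]].

(* The word s_1 t_1 s_2 t_2 ... of a partition into pairs; enum lists each
   pair {s_l, t_l} increasingly, so s_l < t_l. The order of the pairs is
   arbitrary, which does not affect the sign of the word. *)
Definition pairing_word (n : nat) (P : {set {set 'I_n}}) : seq 'I_n :=
  flatten [seq enum B | B : {set 'I_n} in P].

(* For B = {s, t} with s < t, the inner double product is the entry A s t.
   If n is odd, pairings n is empty and the Pfaffian is 0. *)
Definition Pfaffian (R : comPzRingType) (n : nat) (A : 'M[R]_n) : R :=
  \sum_(P in pairings n)
    (rearr_sign (idword n) (pairing_word P))%:~R *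
    \prod_(B in P) \prod_(s in B) \prod_(t in B | (s < t)%N) A s t.

(* A_I : enum_val lists the indices outside I increasingly. *)
Definition del_mx (R : Type) (n : nat) (A : 'M[R]_n) (I : {set 'I_n}) :
    'M[R]_#|~: I| :=
  mxsub (@enum_val _ [in ~: I]) (@enum_val _ [in ~: I]) A.

(* E(A). *)
Definition zero_mx (R : pzRingType) (n : nat) (E : {set 'I_n * 'I_n})
    (A : 'M[R]_n) : 'M[R]_n :=
  \matrix_(i, j) if ((i, j) \in E) || ((j, i) \in E) then 0 else A i j.

(* Main.v *)
(* Encode the cofactors of a skew symmetric matrix A in the matrix
   pfadj A = (s([n], i v) Pf(A_{i,v})), which is skew symmetric. Expanding the
   Pfaffian along a row gives A (pfadj A) = (pfadj A) A = - Pf(A) I; the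
   off-diagonal entries vanish because expanding Pf(A_{i,v}) again along row j
   gives a double sum that is antisymmetric in the two summation indices. With
   B = E(A), evaluating (pfadj B) (A - B) (pfadj A) in two ways yields
     (pfadj B) (A - B) (pfadj A) = Pf(B) pfadj A - Pf(A) pfadj B.
   Since A - B is supported on E, its (i_p, j_p) entry is the sum over l in [k]
   of the theorem; the term l = p combines with the expansions of Pf(E_p(A))
   and Pf(A) in the single entry a_{i_p j_p}. *)
Require Import Defs.
From mathcomp Require Import all_boot all_order all_fingroup all_algebra.
From mathcomp Require Import reals ring.

Set Implicit Arguments.
Unset Strict Implicit.
Unset Printing Implicit Defensive.

Import Order.TTheory GRing.Theory Num.Theory.
Local Open Scope ring_scope.

(** * Signs of words by counting inversions *)

(** The sign contributed by [x] standing before [y]; the value 0 on equal letters makes products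
    over pairs vanish on repeated letters. *)
Definition osg (x y : nat) : int := sgz (y%:Z - x%:Z).

Lemma osgC x y : osg y x = - osg x y.
Proof. by rewrite /osg -sgzN opprB. Qed.

Lemma osgxx x : osg x x = 0.
Proof. by rewrite /osg subrr. Qed.

Lemma osg_lt x y : (x < y)%N -> osg x y = 1.
Proof. by move=> ltxy; rewrite /osg gtr0_sgz // subr_gt0 ltz_nat. Qed.

Lemma osg_gt x y : (y < x)%N -> osg x y = -1.
Proof. by move=> ltyx; rewrite osgC osg_lt. Qed.

(* (-1) to the number of inversions of w, or 0 if w has a repeated letter. *)
Fixpoint isign n (w : seq 'I_n) : int :=
  if w is x :: w' then (\prod_(y <- w') osg x y) * isign w' else 1.

Definition cross n (u v : seq 'I_n) : int :=
  \prod_(x <- u) \prod_(y <- v) osg x y.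

Lemma isign_cat n (u v : seq 'I_n) :
  isign (u ++ v) = isign u * isign v * cross u v.
Proof.
rewrite /cross; elim: u => [|x u IHu] /=; first by rewrite big_nil mulr1 mul1r.
by rewrite big_cons IHu big_cat /= mulrACA -!mulrA; do 2![congr (_ * _)]; rewrite mulrCA.
Qed.

(** Exchanging the words flips each of the [size u * size v] factors, an even number of them. *)
Lemma crossC n (u v : seq 'I_n) : ~~ odd (size u) -> cross v u = cross u v.
Proof.
move=> evu; rewrite /cross exchange_big /=.
under eq_bigr do under eq_bigr do rewrite osgC -mulN1r.
under eq_bigr do rewrite big_split big_const_seq count_predT -Monoid.iteropE /=.
rewrite big_split big_const_seq count_predT -Monoid.iteropE /=.
rewrite -!/(GRing.exp _ _) -exprM mulnC.
by rewrite exprM -signr_odd (negPf evu) expr0 expr1n mul1r.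
Qed.

Lemma isign_rot n (u v : seq 'I_n) :
  ~~ odd (size u) -> isign (v ++ u) = isign (u ++ v).
Proof. by move=> evu; rewrite !isign_cat crossC // [isign v * _]mulrC. Qed.

(** Gives the sign the shape of a Vandermonde product. *)
Lemma isign_codom n m (f : 'I_m -> 'I_n) :
  isign (codom f) = \prod_(a < m) \prod_(b < m | (a < b)%N) osg (f a) (f b).
Proof.
elim: m f => [|m IHm] f.
  by rewrite codomE enum_ord0 big_ord0.
rewrite codomE enum_ordSl /= -map_comp -codomE IHm big_ord_recl.
congr (_ * _).
  rewrite [RHS]big_mkcond big_ord_recl /= mul1r codomE big_map big_enum /=.
  exact: eq_bigr.
by apply: eq_bigr => a _; rewrite [RHS]big_mkcond big_ord_recl /= mul1r -big_mkcond.
Qed.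

Lemma isign_sorted n (w : seq 'I_n) :
  pairwise (fun x y : 'I_n => (x < y)%N) w -> isign w = 1.
Proof.
elim: w => //= x w IHw /andP[/allP ltxw /IHw ->]; rewrite mulr1 big_seq big1 // => y /ltxw.
exact: osg_lt.
Qed.

Lemma pairwise_enum_ord n (a : pred 'I_n) :
  pairwise (fun x y : 'I_n => (x < y)%N) (enum a).
Proof.
rewrite {1}/enum_mem -enumT; apply: subseq_pairwise (filter_subseq _ _) _.
rewrite -(pairwise_map val ltn) val_enum_ord.
by rewrite -sorted_pairwise ?iota_ltn_sorted //; apply: ltn_trans.
Qed.

Lemma isign_enum n (a : pred 'I_n) : isign (enum a) = 1.
Proof. exact/isign_sorted/pairwise_enum_ord. Qed.

(* Permuting the columns of a Vandermonde matrix of the letters multiplies its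
   determinant, the product of their differences, by the sign. *)
Lemma isign_perm n m (f : 'I_m -> 'I_n) (s : 'S_m) :
  isign (codom (f \o s)) = (-1) ^+ s * isign (codom f).
Proof.
rewrite !isign_codom; pose a : 'rV[int]_m := \row_c (f c)%:Z.
have sgz_prod (b : 'rV[int]_m) :
    \prod_(c < m) \prod_(d < m | (c < d)%N) sgz (b 0 d - b 0 c)
    = sgz (\det (Vandermonde m b)).
  rewrite det_Vandermonde (big_morph _ (@sgzM _) (sgz1 _)).
  by apply: eq_bigr => c _; rewrite (big_morph _ (@sgzM _) (sgz1 _)).
have sgzE (g : 'I_m -> 'I_n) :
    \prod_(c < m) \prod_(d < m | (c < d)%N) osg (g c) (g d)
    = sgz (\det (Vandermonde m (\row_c (g c)%:Z))).
  rewrite -sgz_prod; apply: eq_bigr => c _; apply: eq_bigr => d _.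
  by rewrite !mxE.
rewrite !sgzE.
have ->: Vandermonde m (\row_c ((f \o s) c)%:Z) = col_perm s (Vandermonde m a).
  by apply/matrixP=> c d; rewrite !mxE.
rewrite col_permE det_mulmx det_perm odd_permV sgzM mulrC.
by case: (odd_perm s); rewrite ?expr0 ?expr1 ?sgzN1 ?sgz1.
Qed.

(** Whichever permutation is picked, [isign_perm] computes its sign from the inversions of [v]. The
    condition [isign u = 1] holds for increasing words. *)
Lemma rearr_sign_isign n (u v : seq 'I_n) :
  isign u = 1 -> perm_eq v u -> rearr_sign u v = isign v.
Proof.
move=> u1; move=> /(tuple_permP (t := in_tuple u)) puv; rewrite /rearr_sign.
case: pickP => [s /eqP Dv|no_s]; last by case: puv => s /eqP; rewrite no_s.
have ->: v = codom (tnth (in_tuple u) \o s).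
  by rewrite Dv /codom /image_mem; apply: eq_map.
by rewrite isign_perm codomE (map_tnth_enum (in_tuple u)) u1 mulr1.
Qed.

(** Blocks of even length move past other words without a sign. This removes the dependence of
    [pairing_word] on the order in which the blocks are listed. *)
Lemma isign_flatten_perm n (us vs : seq (seq 'I_n)) :
    all (fun u => ~~ odd (size u)) us -> perm_eq us vs ->
  isign (flatten us) = isign (flatten vs).
Proof.
elim: us vs => [|u us IHus] vs /=; first by rewrite perm_sym => _ /perm_nilP->.
move=> /andP[evu evus] puv.
have /splitPr vsE : u \in vs by rewrite -(perm_mem puv) mem_head.
case: vsE puv => v1 v2 puv.
have {}puv : perm_eq us (v1 ++ v2).
  by rewrite -(perm_cons u) (perm_trans puv) // -cat_cons -cat1s catA perm_cat2r perm_catC.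
have -> : isign (flatten (v1 ++ u :: v2)) = isign (u ++ flatten (v1 ++ v2)).
  rewrite !flatten_cat /= !catA !(isign_cat _ (flatten v2)).
  by rewrite isign_rot // /cross !big_cat /= [X in _ * X]mulrC.
rewrite !isign_cat (IHus _ evus puv); congr (_ * _).
by apply: eq_bigr => x _; apply: perm_big; apply: perm_flatten.
Qed.

(** * Partitions of an index set into pairs *)

Definition pairings_of n (S : {set 'I_n}) : {set {set {set 'I_n}}} :=
  [set P : {set {set 'I_n}} | partition P S && [forall B in P, #|B| == 2]].

Lemma pairing_word_perm n (S : {set 'I_n}) (P : {set {set 'I_n}}) :
  partition P S -> perm_eq (pairing_word P) (enum S).
Proof.
move=> partP; have mem_w: pairing_word P =i enum S.
  move=> x; rewrite mem_enum -(cover_partition partP); apply/flattenP/bigcupP.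
    by case=> w /imageP[B BP ->]; rewrite mem_enum; exists B.
  by case=> B BP xB; exists (enum B); [apply: image_f | rewrite mem_enum].
apply: (uniq_perm _ (enum_uniq _) mem_w).
(* A word with the same letters as [enum S] and no longer than it has no repeated letter. *)
apply: (leq_size_uniq (enum_uniq S)); first by move=> x; rewrite mem_w.
rewrite -cardE (card_partition partP) /pairing_word size_flatten /shape.
rewrite sumnE big_map big_image /=; apply/eq_leq/eq_bigr => B _.
by rewrite cardE.
Qed.

Lemma notin_partitionD (T : finType) (P : {set {set T}}) (S B : {set T}) x :
  partition P (S :\: B) -> x \in B -> B \notin P.
Proof.
move=> partP Bx; apply/negP=> BP.
have : x \in S :\: B by rewrite -(cover_partition partP); apply/bigcupP; exists B.
by rewrite inE Bx.
Qed.

(** With the block of [i] and [v] moved to the front, the new inversions are those of [i] and [v]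
    against the other letters. The block itself is listed increasingly and contributes 1. *)
Lemma pairing_wordU1 n (S : {set 'I_n}) (i v : 'I_n) (P : {set {set 'I_n}}) :
    i != v -> P \in pairings_of (S :\: [set i; v]) ->
  isign (pairing_word ([set i; v] |: P)) =
  (\prod_(y in S :\: [set i; v]) (osg i y * osg v y)) * isign (pairing_word P).
Proof.
move=> neq_iv; rewrite inE => /andP[partP /forall_inP P2].
set B := [set i; v].
have BnP : B \notin P := notin_partitionD partP (set21 i v).
have pP : perm_eq [seq enum C | C : {set 'I_n} in B |: P]
                  (enum B :: [seq enum C | C : {set 'I_n} in P]).
  rewrite /image_mem -(map_cons (fun C : {set 'I_n} => enum C)); apply: perm_map.
  apply: uniq_perm; rewrite ?enum_uniq //=.
    by rewrite mem_enum BnP enum_uniq.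
  by move=> C; rewrite in_cons !mem_enum in_setU1.
rewrite {1}/pairing_word (isign_flatten_perm _ pP) /=; last first.
  apply/allP=> _ /imageP[C + ->]; rewrite -cardE in_setU1 => /predU1P[->|/P2/eqP->//].
  by rewrite cards2 neq_iv.
rewrite isign_cat isign_enum mul1r mulrC; congr (_ * _).
rewrite /cross big_enum /= big_setU1 ?inE //= big_set1 -big_split /=.
by rewrite (perm_big _ (pairing_word_perm partP)) /= big_enum.
Qed.

(** * Pfaffians on index subsets and their expansion along a row *)

Section PfaffianOn.

Variables (R : comNzRingType) (n : nat).
Implicit Types (A : 'M[R]_n) (S : {set 'I_n}) (P : {set {set 'I_n}}).

Definition block_entry A (B : {set 'I_n}) : R :=
  \prod_(s in B) \prod_(t in B | (s < t)%N) A s t.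

(* Pfaffian of the principal submatrix of A on the index set S. *)
Definition pf_on A S : R :=
  \sum_(P in pairings_of S)
    (isign (pairing_word P))%:~R * \prod_(B in P) block_entry A B.

Lemma Pfaffian_pf_on A : Pfaffian A = pf_on A setT.
Proof.
apply: eq_big => [P | P]; first by rewrite !inE.
rewrite inE => /andP[partP _]; rewrite rearr_sign_isign ?isign_enum //.
by rewrite (perm_trans (pairing_word_perm partP)) // (eq_enum (in_setT (T := 'I_n))).
Qed.

Lemma pf_on0 A : pf_on A set0 = 1.
Proof.
rewrite /pf_on (big_pred1 set0) => [|P].
  by rewrite big_set0 mulr1 /pairing_word /image_mem enum_set0.
rewrite inE partition_set0; apply: andb_idr => /eqP->.
by apply/forall_inP => B; rewrite inE.
Qed.

Lemma block_entry_pair A (i v : 'I_n) : A^T = - A -> i != v ->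
  block_entry A [set i; v] = (osg i v)%:~R * A i v.
Proof.
move=> skA neq_iv; rewrite /block_entry big_setU1 ?inE //= big_set1.
rewrite big_mkcondr [X in _ * X]big_mkcondr /= !big_setU1 ?inE //= !big_set1 !ltnn mul1r mulr1.
case: ltngtP neq_iv => [lt _|gt _|/val_inj-> /eqP//]; rewrite ?mulr1 ?mul1r.
- by rewrite osg_lt ?mul1r.
- by rewrite osg_gt // mulN1r; have /matrixP/(_ i v) := skA; rewrite !mxE.
Qed.

(* s(S, i v), for S written in increasing order and i, v in S. *)
Definition cosign S (i v : 'I_n) : int :=
  osg i v * \prod_(y in S :\: [set i; v]) (osg i y * osg v y).

(** Group the pairings by the partner [v] of [i], and remove the block they form. *)
Lemma pf_on_expand A S i : A^T = - A -> i \in S ->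
  pf_on A S =
  \sum_(v in S) (cosign S i v)%:~R * A i v * pf_on A (S :\: [set i; v]).
Proof.
move=> skA Si.
(* For each [P] the inner sum has exactly one term, the partner of [i] in its block. *)
transitivity (\sum_(P in pairings_of S) \sum_(v in S | (v != i) && ([set i; v] \in P))
    (isign (pairing_word P))%:~R * \prod_(B in P) block_entry A B).
  apply: eq_bigr => P; rewrite inE => /andP[partP /forall_inP P2].
  have covP := cover_partition partP; have tiP := partition_trivIset partP.
  have iP : i \in cover P by rewrite covP.
  have BP := pblock_mem iP; have iB : i \in pblock P i by rewrite mem_pblock.
  have /cards2P[x [y [neq_xy defB]]] := P2 _ BP.
  have [v neq_vi {x y neq_xy}defB] : exists2 v, v != i & pblock P i = [set i; v].
    move: iB; rewrite defB !inE => /orP[]/eqP->; first by exists y; rewrite // eq_sym.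
    by exists x; rewrite // setUC.
  rewrite (big_pred1 v) // => w /=; apply/and3P/eqP => [[Sw neq_wi iwP]|->].
    have : w \in pblock P i by rewrite (def_pblock tiP iwP) !inE eqxx ?orbT.
    by rewrite defB !inE (negPf neq_wi) => /eqP.
  split=> //; last by rewrite -defB.
  by rewrite -covP; apply/bigcupP; exists (pblock P i) => //; rewrite defB !inE eqxx orbT.
rewrite (exchange_big_dep (fun v => (v \in S) && (v != i))) /=; last first.
  by move=> P v _ /and3P[-> ->].
(* The term [v = i] corresponds to no pairing, and its sign [cosign S i i] is 0. *)
rewrite big_mkcondr; apply: eq_bigr => v Sv; case: eqP => [->|/eqP neq_vi] /=.
  by rewrite /cosign osgxx mul0r !mul0r.
have neq_iv : i != v by rewrite eq_sym.
rewrite Sv /= mulr_sumr.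
(* Adding the block of [i] and [v] is a bijection from the pairings of the remaining indices to the
   pairings of [S] containing it. *)
rewrite (reindex_onto (fun P => [set i; v] |: P) (fun P => P :\ [set i; v])) /=; last first.
  by move=> P /andP[_ ?]; rewrite setD1K.
apply: eq_big => [P|P].
  rewrite setU11 andbT !inE.
  apply/idP/idP=> [/andP[/andP[partP /forall_inP P2] /eqP defP]|/andP[partP /forall_inP P2]].
    have:= partitionD1 partP (setU11 _ _); rewrite defP => ->.
    by apply/forall_inP=> B BP; apply: P2; rewrite inE BP orbT.
  have ivS : [set i; v] \subset S by rewrite subUset !sub1set Si.
  rewrite setU1K ?eqxx ?andbT ?(notin_partitionD partP (set21 i v)) //.
  apply/andP; split.
    rewrite -[S](setID _ [set i; v]) (setIidPr ivS); apply: partitionU1 => //.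
      by apply/set0Pn; exists i; rewrite !inE eqxx.
    by rewrite -setI_eq0 setIDA setIC setDIl setDv setI0.
  by apply/forall_inP=> B; rewrite in_setU1 => /predU1P[->|/P2//]; rewrite cards2 neq_iv.
move=> /andP[/andP[pP _] /eqP defP].
have pP' : P \in pairings_of (S :\: [set i; v]).
  move: pP; rewrite !inE => /andP[partP /forall_inP P2].
  have:= partitionD1 partP (setU11 _ _); rewrite defP => ->.
  by apply/forall_inP=> B BP; apply: P2; rewrite inE BP orbT.
rewrite (pairing_wordU1 neq_iv pP') big_setU1 /=; last by rewrite -defP !inE eqxx.
rewrite block_entry_pair // /cosign !rmorphM /=.
by rewrite mulrACA; congr (_ * _); rewrite mulrCA mulrA.
Qed.

End PfaffianOn.

Lemma pf_on_eq (R : comNzRingType) n (A B : 'M[R]_n) (S : {set 'I_n}) :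
  {in S &, A =2 B} -> pf_on A S = pf_on B S.
Proof.
move=> eqAB; apply: eq_bigr => P; rewrite inE => /andP[partP _]; congr (_ * _).
have subS C x : C \in P -> x \in C -> x \in S.
  by move=> CP Cx; rewrite -(cover_partition partP); apply/bigcupP; exists C.
apply: eq_bigr => C CP; apply: eq_bigr => s Cs; apply: eq_bigr => t /andP[Ct _].
by apply: eqAB; apply: (subS C).
Qed.

Lemma cosignC n (S : {set 'I_n}) i v : cosign S v i = - cosign S i v.
Proof.
rewrite /cosign osgC mulNr setUC; congr (- (_ * _)).
by apply: eq_bigr => y _; rewrite mulrC.
Qed.

Lemma cosignxx n (S : {set 'I_n}) i : cosign S i i = 0.
Proof. by rewrite /cosign osgxx mul0r. Qed.

(** * Deleted matrices and word signs in terms of index subsets *)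

(** Induction on the size of [S] by row expansion: an increasing [f] preserves [osg], hence every
    [cosign]. *)
Lemma pf_on_mxsub (R : comNzRingType) m n (f : 'I_m -> 'I_n) (A : 'M[R]_n)
    (S : {set 'I_m}) :
    {mono f : x y / (x < y)%N} -> A^T = - A ->
  pf_on (mxsub f f A) S = pf_on A (f @: S).
Proof.
move=> f_mono skA.
have f_inj : injective f.
  move=> x y eq_f; apply/val_inj.
  by case: (ltngtP x y) => //; rewrite -f_mono eq_f ltnn.
have osgf x y : osg (f x) (f y) = osg x y.
  case: (ltngtP x y) => [lt|gt|/val_inj->]; last by rewrite !osgxx.
    by rewrite !osg_lt // f_mono.
  by rewrite !osg_gt // f_mono.
have skAf : (mxsub f f A)^T = - mxsub f f A.
  by apply/matrixP=> x y; have /matrixP/(_ (f x) (f y)) := skA; rewrite !mxE.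
have [k leSk] := ubnP #|S|; elim: k => // k IHk in S leSk *.
have [->|[i Si]] := set_0Vmem S; first by rewrite imset0 !pf_on0.
have fSi : f i \in f @: S by apply: imset_f.
rewrite (pf_on_expand skAf Si) (pf_on_expand skA fSi) big_imset /=; last first.
  by move=> x y _ _; apply: f_inj.
apply: eq_bigr => v Sv.
have fD : f @: (S :\: [set i; v]) = f @: S :\: [set f i; f v].
  rewrite -(imset_set1 f v) -imsetU1; apply/setP=> y.
  apply/imsetP/setDP => [[x /setDP[Sx Nx] ->]|[/imsetP[x Sx ->]]].
    by rewrite !(mem_imset _ _ f_inj).
  by rewrite (mem_imset _ _ f_inj) => Nx; exists x; rewrite // inE Nx.
rewrite -fD IHk ?mxE; last first.
  rewrite -ltnS (leq_trans _ leSk) // ltnS proper_card //.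
  apply/properP; split; [exact: subsetDl | by exists i; rewrite // !inE eqxx].
congr (_ %:~R * _ * _); rewrite /cosign osgf -fD big_imset /=; last first.
  by move=> x y _ _; apply: f_inj.
by congr (_ * _); apply: eq_bigr => y _; rewrite !osgf.
Qed.

Lemma Pfaffian_del_mx (R : comNzRingType) n (A : 'M[R]_n) (I : {set 'I_n}) :
  A^T = - A -> Pfaffian (del_mx A I) = pf_on A (~: I).
Proof.
move=> skA; rewrite Pfaffian_pf_on pf_on_mxsub //; last first.
  move=> x y.
  have homo (z t : 'I_#|~: I|) : (z < t)%N -> (enum_val z < enum_val t)%N.
    move=> ltzt; have x0 := enum_val z; rewrite !(enum_val_nth x0).
    have /(pairwiseP x0) := pairwise_enum_ord [in ~: I].
    by apply; rewrite ?inE -?cardE.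
  apply/idP/idP; last exact: homo.
  case: (ltngtP x y) => // [/homo|/val_inj->]; last by rewrite ltnn.
  by move=> /ltnW; rewrite leqNgt => /negPf->.
congr (pf_on _ _); apply/setP=> x; apply/imsetP/idP => [[y _ ->]|Ix].
  exact: enum_valP.
by exists (enum_rank_in Ix x); rewrite ?enum_rankK_in.
Qed.

(** The letters after [u] and [v] remain increasing, so the only possible inversions are within the
    pair or between the pair and the rest. *)
Lemma word_sign_pair n (u v : 'I_n) :
  word_sign (idword n) [:: u; v] = cosign setT u v.
Proof.
rewrite /word_sign /idword enum_uniq /= inE andbT.
have [->|neq_uv] /= := eqVneq u v; first by rewrite cosignxx.
rewrite !mem_enum /= rearr_sign_isign ?isign_enum //=; last first.
  apply: uniq_perm; rewrite ?enum_uniq //=.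
    by rewrite inE negb_or neq_uv !mem_filter !inE !eqxx orbT filter_uniq ?enum_uniq.
  by move=> x; rewrite !inE mem_filter !inE mem_enum andbT; do 2!case: eqP.
rewrite big_cons isign_sorted ?mulr1; last first.
  by apply: subseq_pairwise (filter_subseq _ _) _; apply: pairwise_enum_ord.
rewrite -mulrA -big_split big_filter big_enum_cond /=; congr (_ * _).
by apply: eq_bigl => y; rewrite !inE andbT.
Qed.

(** * Pfaffian cofactors and the adjugate identity *)

(** Once [j, w] or [j, v] is split off the product, both sides share the product over the remaining
    letters. The other factors differ by three reversals of order, among [j], [v] and [w]. *)
Lemma cosign_swap n (S : {set 'I_n}) (i j v w : 'I_n) :
    uniq [:: i; j; v; w] -> [set i; j; v; w] \subset S ->
  cosign S i v * cosign (S :\: [set i; v]) j w =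
  - (cosign S i w * cosign (S :\: [set i; w]) j v).
Proof.
rewrite /= !inE !negb_or => /and4P[/and3P[ij iv iw] /andP[jv jw] vw _].
rewrite !subUset !sub1set => /andP[/andP[/andP[iS jS] vS] wS].
have DU : S :\: [set i; w] :\: [set j; v] = S :\: [set i; v] :\: [set j; w].
  by apply/setP=> x; rewrite !inE; do !case: eqP.
have pull (a b c d : 'I_n) (h : 'I_n -> int) : c \in S -> d \in S ->
    c != a -> c != b -> d != a -> d != b -> c != d ->
    \prod_(y in S :\: [set a; b]) h y =
    h c * h d * \prod_(y in S :\: [set a; b] :\: [set c; d]) h y.
  move=> cS dS ca cb da db cd; rewrite (big_setID [set c; d]) /= (setIidPr _).
    by rewrite big_setU1 ?inE //= big_set1.
  by rewrite subUset !sub1set !inE cS dS !negb_or ca cb da db.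
rewrite /cosign (pull i v j w) // 1?eq_sym // (pull i w j v) // 1?eq_sym // DU.
rewrite !big_split /= (osgC j v) (osgC j w) (osgC v w).
ring.
Qed.

Section PfaffianAdjugate.

Variables (R : numDomainType) (n : nat).
Implicit Types A B : 'M[R]_n.

Definition pfadj A : 'M[R]_n :=
  \matrix_(i, v) ((cosign setT i v)%:~R * pf_on A (~: [set i; v])).

Lemma pfadjC A i v : pfadj A v i = - pfadj A i v.
Proof. by rewrite !mxE cosignC setUC rmorphN mulNr. Qed.

Lemma pfadj_tr A : (pfadj A)^T = - pfadj A.
Proof. by apply/matrixP=> i v; rewrite [LHS]mxE pfadjC [RHS]mxE. Qed.

Lemma skew_diag A i : A^T = - A -> A i i = 0.
Proof.
move=> /matrixP/(_ i i); rewrite !mxE => /esym/eqP.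
by rewrite eqNr => /eqP.
Qed.

Lemma Pfaffian_expand A i : A^T = - A -> Pfaffian A = \sum_v A i v * pfadj A i v.
Proof.
move=> skA; rewrite Pfaffian_pf_on (pf_on_expand skA (in_setT i)).
apply: eq_big => [v|v _]; rewrite ?inE // mxE setTD.
by rewrite mulrCA mulrA.
Qed.

Lemma pfadj_alt A i j : A^T = - A -> i != j -> \sum_v A j v * pfadj A i v = 0.
Proof.
move=> skA neq_ij.
(* [G v w] is a term of the double expansion along rows [i] and [j], set to 0 where [w] is already
   deleted. *)
pose G v w := if w \in ~: [set i; v] then
    (cosign setT i v * cosign (~: [set i; v]) j w)%:~R * (A j v * A j w)
      * pf_on A (~: [set i; v] :\: [set j; w])
  else 0.
have simp0 := (mul0r, mulr0, mulr0z, oppr0).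
(* When [v = w] or an index equals [i] or [j], both sides vanish by the guard, a zero sign or a zero
   diagonal entry; otherwise [cosign_swap] applies. *)
have GC v w : G w v = - G v w.
  rewrite /G !inE !negb_or.
  have [->|neq_wi] := eqVneq w i; first by rewrite /= cosignxx !(simp0, if_same).
  have [->|neq_vi] := eqVneq v i; first by rewrite /= cosignxx !(simp0, if_same).
  have [->|neq_wv] := eqVneq w v; first by rewrite !simp0.
  have [->|neq_vj] := eqVneq v j; first by rewrite skew_diag // cosignxx !(simp0, if_same).
  have [->|neq_wj] := eqVneq w j; first by rewrite skew_diag // cosignxx !(simp0, if_same).
  rewrite /= -!setTD cosign_swap; last first.
  - exact: subsetT.
  - by rewrite /= !inE !negb_or neq_ij (eq_sym i w) neq_wi (eq_sym i v) neq_vi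
       (eq_sym j w) neq_wj (eq_sym j v) neq_vj neq_wv.
  rewrite rmorphN !mulNr (mulrC (A j w)); congr (- (_ * pf_on A _)).
  by apply/setP=> x; rewrite !inE; do !case: eqP.
have -> : \sum_v A j v * pfadj A i v = \sum_v \sum_w G v w.
  apply: eq_bigr => v _; rewrite -big_mkcond /= mxE.
  have [->|neq_vi] := eqVneq v i.
    by rewrite cosignxx !simp0 big1 // => w _; rewrite !simp0.
  have [->|neq_vj] := eqVneq v j.
    by rewrite skew_diag // !simp0 big1 // => w _; rewrite !simp0.
  have jS : j \in ~: [set i; v] by rewrite !inE negb_or eq_sym neq_ij eq_sym.
  rewrite (pf_on_expand skA jS) !mulr_sumr; apply: eq_bigr => w _.
  by rewrite [(cosign _ i v * _)%:~R]intrM; ring.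
(* The double sum equals its own negative, so it is 0 in a numeric domain. *)
apply/eqP; rewrite -eqNr [eqbRHS]exchange_big -sumrN; apply/eqP/eq_bigr => v _.
by rewrite -sumrN; apply: eq_bigr => w _; rewrite (GC v w).
Qed.

Lemma mul_pfadj A : A^T = - A -> A *m pfadj A = - (Pfaffian A)%:M.
Proof.
move=> skA; apply/matrixP=> j i; rewrite !mxE.
transitivity (- \sum_v A j v * pfadj A i v).
  by rewrite -sumrN; apply: eq_bigr => v _; rewrite (pfadjC A i) mulrN.
have [->|neq_ji] := eqVneq j i; first by rewrite (Pfaffian_expand i skA).
by rewrite pfadj_alt // eq_sym.
Qed.

Lemma pfadj_mul A : A^T = - A -> pfadj A *m A = - (Pfaffian A)%:M.
Proof.
move=> skA; rewrite -[LHS]trmxK trmx_mul pfadj_tr skA mulNmx mulmxN opprK.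
by rewrite mul_pfadj // linearN /= tr_scalar_mx.
Qed.

Lemma pfadj_sub A B : A^T = - A -> B^T = - B ->
  pfadj B *m (A - B) *m pfadj A = Pfaffian B *: pfadj A - Pfaffian A *: pfadj B.
Proof.
move=> skA skB; rewrite mulmxBr mulmxBl -mulmxA mul_pfadj // pfadj_mul //.
by rewrite mulmxN mulNmx opprK mul_mx_scalar mul_scalar_mx addrC.
Qed.

(** Cofactors along row [i] omit row and column [i], so they agree for [A] and [B]; only the term
    [v = j] of the expansion changes. *)
Lemma Pfaffian_change_entry A B i j :
    A^T = - A -> B^T = - B -> i != j ->
    (forall u v, (u, v) != (i, j) -> (u, v) != (j, i) -> A u v = B u v) ->
  Pfaffian A = Pfaffian B + (A i j - B i j) * pfadj B i j.
Proof.
move=> skA skB neq_ij eqAB; rewrite !(Pfaffian_expand i) //.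
have adjE v : pfadj A i v = pfadj B i v.
  rewrite !mxE; congr (_ * _); apply: pf_on_eq => x y; rewrite !inE !negb_or.
  move=> /andP[xi _] /andP[yi _]; apply: eqAB.
    by rewrite xpair_eqE (negPf xi).
  by rewrite xpair_eqE (negPf yi) andbF.
rewrite (bigD1 j) // [in RHS](bigD1 j) //= adjE.
rewrite (eq_bigr (fun v => B i v * pfadj B i v)) => [|v neq_vj]; first by ring.
by rewrite adjE eqAB // xpair_eqE negb_and ?neq_vj ?neq_ij ?orbT.
Qed.

End PfaffianAdjugate.

(** * Zeroed entries and the final identity *)

Lemma zero_mx_skew (R : pzRingType) n (E : {set 'I_n * 'I_n}) (A : 'M[R]_n) :
  A^T = - A -> (zero_mx E A)^T = - zero_mx E A.
Proof.
move=> skA; apply/matrixP=> u v; rewrite !mxE orbC; case: ifP; rewrite ?oppr0 //.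
by have /matrixP/(_ u v) := skA; rewrite !mxE.
Qed.

Lemma mulmx_delta_mx (R : pzRingType) m n q r (A : 'M[R]_(m, n)) (B : 'M[R]_(q, r))
    (u : 'I_n) (v : 'I_q) i j :
  (A *m delta_mx u v *m B) i j = A i u * B v j.
Proof.
(* An elementary matrix is a column times a row, which splits the product into a column of [A] and a
   row of [B]. *)
rewrite -(mul_delta_mx (0 : 'I_1)) mulmxA -mulmxA -colE -rowE.
by rewrite !mxE big_ord1 !mxE.
Qed.

Lemma sub_zero_mx (R : pzRingType) n (E : {set 'I_n * 'I_n}) (A : 'M[R]_n) :
    A^T = - A -> (forall e, e \in E -> (e.1 < e.2)%N) ->
  A - zero_mx E A =
  \sum_(e in E) A e.1 e.2 *: (delta_mx e.1 e.2 - delta_mx e.2 e.1).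
Proof.
move=> skA ltE; apply/matrixP=> u v; rewrite summxE !mxE.
transitivity (\sum_(e in E) ((if e == (u, v) then A u v else 0)
                            + (if e == (v, u) then A u v else 0))).
  rewrite big_split /= -!big_mkcondr /=.
  have pick x : \sum_(e in E | e == x) A u v = if x \in E then A u v else 0.
    by rewrite big_mkcondl /= (eq_bigl (pred1 x)) // big_pred1_eq.
  rewrite !pick; have [uvE|_] := boolP (_ \in E); have [vuE|_] := boolP (_ \in E);
    rewrite /= ?subr0 ?subrr ?addr0 ?add0r //.
  (* Both orders of a pair cannot lie in [E], so no entry is counted twice. *)
  by have := ltn_trans (ltE _ uvE) (ltE _ vuE); rewrite ltnn.
have skE w z : A z w = - A w z by have /matrixP/(_ w z) := skA; rewrite !mxE.
apply: eq_bigr => -[x y] _; rewrite !mxE !xpair_eqE /= mulrBr ![_ == u]eq_sym ![_ == v]eq_sym.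
congr (_ + _).
  by do 2!case: eqP => [->|_]; rewrite ?mulr1 ?mulr0.
by rewrite andbC; do 2!case: eqP => [->|_]; rewrite ?mulr1 ?mulr0 ?oppr0 -?skE.
Qed.

Theorem theorem3p1 (R : realType) (n : nat) (hn : ~~ odd n)
    (A : 'M[R]_n) (hA : A^T = - A)
    (k : nat) (hk : (0 < k)%N) (i j : 'I_k -> 'I_n)
    (hdistinct : injective (fun l : 'I_k => (i l, j l)))
    (hsorted : forall l m : 'I_k, (l <= m)%N -> (i l <= i m)%N)
    (hij : forall l : 'I_k, (i l < j l)%N)
    (p : 'I_k) :
  let E : {set 'I_n * 'I_n} := [set (i l, j l) | l : 'I_k] in
  let Ep := E :\ (i p, j p) in
  let Ep_bar : {set 'I_n * 'I_n} := [set (i p, j p)] in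
  let s := word_sign (idword n) in
  let f (q l : 'I_k) : int := s [:: i q; j l] * s [:: j q; i l] in
  let g (q l : 'I_k) : int := s [:: i q; i l] * s [:: j q; j l] in
  Pfaffian (zero_mx E A) * Pfaffian A =
  Pfaffian (zero_mx Ep A) * Pfaffian (zero_mx Ep_bar A) +
  A (i p) (j p) *
    \sum_(l < k | l != p) A (i l) (j l) *
      ((f p l)%:~R * Pfaffian (del_mx (zero_mx E A) [set i p; j l])
                   * Pfaffian (del_mx A [set j p; i l])
       - (g p l)%:~R * Pfaffian (del_mx (zero_mx E A) [set i p; i l])
                     * Pfaffian (del_mx A [set j p; j l])).
Proof.
move=> E Ep Ep_bar s f g.
have ltE e : e \in E -> (e.1 < e.2)%N by case/imsetP=> l _ ->; apply: hij.
have pE : (i p, j p) \in E by apply: imset_f.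
have neq_ij l : i l != j l by rewrite neq_ltn hij.
have skE := zero_mx_skew E hA; have skEp := zero_mx_skew Ep hA.
have skEb := zero_mx_skew Ep_bar hA.
set B := zero_mx E A; set a := A (i p) (j p).
have jiE : (j p, i p) \notin E.
  by apply/negP=> /ltE /=; rewrite ltnNge ltnW.
(* The two matrices differ only at this entry and its mirror: it is [a] on the left and 0 on the
   right. *)
have PfEp : Pfaffian (zero_mx Ep A) = Pfaffian B + a * pfadj B (i p) (j p).
  rewrite (Pfaffian_change_entry skEp skE (neq_ij p)).
    by rewrite !mxE pE !inE eqxx /= (negPf jiE) andbF subr0.
  move=> u v neq_uv neq_vu; rewrite !mxE !inE neq_uv.
  suff -> : (v, u) != (i p, j p) by [].
  by apply: contra neq_vu; rewrite !xpair_eqE andbC.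
have PfEb : Pfaffian A = Pfaffian (zero_mx Ep_bar A) + a * pfadj A (i p) (j p).
  rewrite {1}(Pfaffian_change_entry hA skEb (neq_ij p)) => [|u v neq_uv neq_vu].
    (* The cofactor deletes rows and columns [i p] and [j p], hence is the same for [A] and
       [zero_mx Ep_bar A]. *)
    rewrite !mxE !inE eqxx subr0; congr (_ + _ * (_ * _)).
    apply: pf_on_eq => u v; rewrite !inE !negb_or.
    move=> /andP[/negPf neq_u _] /andP[/negPf neq_v _].
    by rewrite !mxE !inE !xpair_eqE neq_u neq_v.
  rewrite !mxE !inE (negPf neq_uv); suff /negPf-> : (v, u) != (i p, j p) by [].
  by apply: contra neq_vu; rewrite !xpair_eqE andbC.
have fE l : (f p l)%:~R * Pfaffian (del_mx B [set i p; j l])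
                   * Pfaffian (del_mx A [set j p; i l])
    = pfadj B (i p) (j l) * pfadj A (j p) (i l).
  by rewrite /f /s !word_sign_pair !Pfaffian_del_mx // intrM !mxE -!mulrA;
    congr (_ * _); rewrite mulrCA.
have gE l : (g p l)%:~R * Pfaffian (del_mx B [set i p; i l])
                   * Pfaffian (del_mx A [set j p; j l])
    = pfadj B (i p) (i l) * pfadj A (j p) (j l).
  by rewrite /g /s !word_sign_pair !Pfaffian_del_mx // intrM !mxE -!mulrA;
    congr (_ * _); rewrite mulrCA.
under eq_bigr do rewrite fE gE.
pose T l := A (i l) (j l) * (pfadj B (i p) (j l) * pfadj A (j p) (i l)
                            - pfadj B (i p) (i l) * pfadj A (j p) (j l)).
have sumT : \sum_l T l = Pfaffian B * pfadj A (i p) (j p)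
                        - Pfaffian A * pfadj B (i p) (j p).
  have /matrixP/(_ (i p) (j p)) := pfadj_sub hA skE.
  rewrite (sub_zero_mx hA ltE) big_imset /=; last by move=> l m _ _; apply: hdistinct.
  rewrite mulmx_sumr mulmx_suml summxE => sumE.
  transitivity ((Pfaffian B *: pfadj A - Pfaffian A *: pfadj B) (i p) (j p)).
    rewrite -sumE; apply: eq_bigr => l _.
    rewrite -scalemxAr -scalemxAl mulmxBr mulmxBl.
    rewrite [fun_of_matrix (_ *: _) _ _]mxE [fun_of_matrix (_ - _) _ _]mxE
      [fun_of_matrix (- _) _ _]mxE !mulmx_delta_mx /T.
    (* The matrix product has column index [j p] on the right; skew symmetry moves it to the row and
       accounts for the signs of [f] and [g]. *)
    rewrite (pfadjC A (j p) (i l)) (pfadjC A (j p) (j l)).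
    by ring.
  by rewrite [fun_of_matrix (_ - _) _ _]mxE [fun_of_matrix (- _) _ _]mxE
    ![fun_of_matrix (_ *: _) _ _]mxE.
have sumTp : \sum_(l < k | l != p) T l = \sum_l T l - T p.
  by rewrite [in RHS](bigD1 p) //= [RHS]addrC addKr.
rewrite -/(T _) sumTp sumT.
have adjBii : pfadj B (i p) (i p) = 0 by rewrite mxE cosignxx mul0r.
(* By skew symmetry [T p] is minus [a] times the two cofactors at [(i p, j p)]. Subtracting it
   cancels the quadratic term in [a] that arises from expanding [Pfaffian A]. *)
rewrite PfEp PfEb /T adjBii (pfadjC A (i p) (j p)) -/a.
ring.
Qed.
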